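(* Consider the following three conditions for a subset $A\subset\langle\mathbb{F}_0\rangle$: (i) for some $\epsilon>0$, $\inf_{f\in A}K^\star(f_0,f)>\epsilon$; (ii) for some $\delta>0$, $\sup_{f\in A}\inf_{0\le\alpha\le1}h^\star_\alpha(f_0,f)<e^{-\delta}$; (iii) for some $0<\alpha_0<1$ and $\eta>0$, $\sup_{f\in A}h^\star_{\alpha_0}(f_0,f)<e^{-\eta}$. For any set $A$, (iii) $\Rightarrow$ (ii) $\Rightarrow$ (i). Further, if the set $A$ is convex, then the three conditions are all equivalent.
   Context: Let $(\mathbb{Y},\mathscr{Y})$ be a measurable space with a $\sigma$-finite measure $\mu$, $\mathbb{F}_0$ a family of probability densities with respect to $\mu$, and $f_0$ a probability density with respect to $\mu$, not necessarily in $\mathbb{F}_0$. $\mathsf{E}_0$ denotes expectation under $f_0$. All sets and functions are understood to be suitably measurable. $K(f_0,f)=\mathsf{E}_0\log(f_0/f)=\int\log(f_0/f)\,f_0\,d\mu$. There is a fixed unique $f^\star\in\mathbb{F}_0$ with $K(f_0,f^\star)=\inf_{f\in\mathbb{F}_0}K(f_0,f)$ (understood to be finite), and for any density $f$, $K^\star(f_0,f)=K(f_0,f)-K(f_0,f^\star)$. A set $A$ of densities is called convex if it is closed under mixtures: for every probability measure $\nu$ on $A$, the density $\int_A f\,\nu(df)$ belongs to $A$. $\langle\mathbb{F}_0\rangle$ is the smallest convex set (in this sense) containing $\mathbb{F}_0$. Standing assumptions: $\int(f/f^\star)f_0\,d\mu<\infty$ for all $f\in\mathbb{F}_0$, and $\int(f_0/f^\star)\,d\mu<\infty$.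 $h^\star_\alpha(f_0,f)=\mathsf{E}_0(f/f^\star)^\alpha=\int(f/f^\star)^\alpha f_0\,d\mu$ for $0<\alpha\le1$, and $h^\star_0(f_0,f)=1$.
   Formalization: For convex A, the implication from (i) to (ii) and (iii) is proved assuming that the integral of (f/f* ) f0 is finite for every f in A, not only in F0; without this it fails for some infinite mixtures. *)

(* Defs.v *)
From HB Require Import structures.
From mathcomp Require Export all_boot all_order all_algebra.
From mathcomp Require Export all_classical all_reals all_analysis.

Set Implicit Arguments.
Unset Strict Implicit.
Unset Printing Implicit Defensive.

Import Order.TTheory GRing.Theory Num.Theory.
Import numFieldNormedType.Exports.

Local Open Scope classical_set_scope.
Local Open Scope ring_scope.
Local Open Scope ereal_scope.

Section misspecified_model.
Context (d : measure_display) (Y : measurableType d) (R : realType).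
Variable mu : {measure set Y -> \bar R}.

Definition is_density (f : Y -> R) : Prop :=
  [/\ measurable_fun setT f, (forall y, (0 <= f y)%R)
    & \int[mu]_y (f y)%:E = 1].

(* A is closed under mixtures.  A probability measure on A is a probability nu,
   for some sigma-algebra on the space of functions Y -> R (any sigma-algebra
   arises as the one generated by G := itself), that is concentrated on a
   measurable B contained in A.  "Suitably measurable" is read as: (f, y) |-> f y
   is jointly measurable on B * Y.  Taking B rather than A itself matters: a
   large A carries no sigma-algebra making evaluation jointly measurable on the
   whole of A * Y, whereas finite and countable mixtures always qualify here,
   with B the set of components.
   A mixture may be infinite on a mu-null set, and densities are only determined
   up to mu-null sets, so all the real-valued versions of a mixture belong to
   A. *)
Definition mixture_convex (A : set (Y -> R)) : Prop :=
  A `<=` is_density /\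
  forall (G : set (set (Y -> R)))
         (nu : probability (g_sigma_algebraType G) R)
         (B : set (g_sigma_algebraType G)) (g : Y -> R),
    measurable B -> B `<=` A -> nu B = 1 ->
    measurable_fun (B `*` [set: Y])
      (fun p : g_sigma_algebraType G * Y => (p.1 : Y -> R) p.2) ->
    is_density g ->
    {ae mu, forall y, (g y)%:E = \int[nu]_(f in B) ((f : Y -> R) y)%:E} ->
    A g.

Definition mixture_hull (F : set (Y -> R)) : set (Y -> R) :=
  smallest mixture_convex F.

(* Quotients of densities are taken in \bar R: f y / 0 is +oo when 0 < f y, and
   0 / 0 is 0. *)
Definition ratio (f g : Y -> R) (y : Y) : \bar R := (f y)%:E / (g y)%:E.

Variables f0 fstar : Y -> R.

(* Expectation under f0.  As 0 * x = 0 for every x in \bar R, what happens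
   where f0 vanishes does not matter. *)
Definition expect0 (X : Y -> \bar R) : \bar R :=
  \int[mu]_y (X y * (f0 y)%:E).

Definition KL (f : Y -> R) : \bar R :=
  expect0 (fun y => lne (ratio f0 f y)).

Definition KLstar (f : Y -> R) : \bar R := KL f - KL fstar.

Definition hstar (a : R) (f : Y -> R) : \bar R :=
  if a == 0%R then 1 else expect0 (fun y => (ratio f fstar y `^ a)).

(* fstar is the minimizer of KL over F0, unique up to mu-null sets, and the
   minimum is finite. *)
Definition KL_unique_minimizer (F0 : set (Y -> R)) : Prop :=
  [/\ F0 fstar, KL fstar \is a fin_num,
      KL fstar = ereal_inf [set KL f | f in F0]
    & forall f, F0 f -> KL f = ereal_inf [set KL g | g in F0] ->
        {ae mu, forall y, f y = fstar y}].

Definition KL_separated (A : set (Y -> R)) : Prop :=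
  exists2 eps : R, (0 < eps)%R & eps%:E < ereal_inf [set KLstar f | f in A].

Definition hstar_inf_separated (A : set (Y -> R)) : Prop :=
  exists2 delta : R, (0 < delta)%R &
    ereal_sup [set ereal_inf [set hstar a f | a in [set a : R | (0 <= a <= 1)%R]]
              | f in A] < (expR (- delta))%:E.

Definition hstar_uniformly_separated (A : set (Y -> R)) : Prop :=
  exists a0 eta : R, [/\ (0 < a0 < 1)%R, (0 < eta)%R &
    ereal_sup [set hstar a0 f | f in A] < (expR (- eta))%:E].

End misspecified_model.

(* Main.v *)
(* Let P be the probability with density f0 and write r = f / fstar, so that
   KLstar f = E(- ln r) and hstar a f = E(r ^ a).  (ii) => (i) is Jensen's
   inequality, and (iii) => (ii) is immediate.

   For convex A, everything follows from "(i), together with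
   E(r ^ a) < +oo for some a > 0 depending on f, implies (iii)".
   - A countable mixture of elements f_n with E(r_n ^ (1 / (n + 2))) large would
     have no finite power moment, so E(r ^ a) <= M for one a > 0 and all f in A.
   - Let T_L = - ln (max r (expR (- L))), which increases to - ln r with L.  If
     for every L some f in A had E(T_L) < e1, a geometric mixture g of
     near-minimisers of E(T_L) for a fast growing sequence of levels L would
     satisfy E(- ln r_g) <= e2, for any given e2 > e1.  Hence (i) yields a single
     level L at which E(T_L) is bounded away from 0 on A.
   - Expanding r ^ b <= 1 - b T_L + b ^ 2 (L ^ 2 + 16 / a ^ 2 * r ^ a) for small
     b then gives a uniform bound E(r ^ b) <= 1 - eta. *)
From HB Require Import structures.
Require Import Defs.
From mathcomp Require Import measurable_realfun ring lra.
Set Implicit Arguments.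
Unset Strict Implicit.
Unset Printing Implicit Defensive.
Import Order.TTheory GRing.Theory Num.Theory.
Import numFieldNormedType.Exports.
Local Open Scope classical_set_scope.
Local Open Scope ring_scope.
Local Open Scope ereal_scope.

(** * Countable mixtures *)

Section probability_of_measure.
Context d (T : measurableType d) (R : realType) (m : {measure set T -> \bar R}).

(** The proof of total mass 1 is an argument so that this alias can carry the probability
    structure. *)
Definition prob_of (_ : m setT = 1) : set T -> \bar R := m.

HB.instance Definition _ m1 := Measure.copy (prob_of m1) m.

HB.instance Definition _ m1 :=
  @Measure_isProbability.Build _ _ R (prob_of m1) m1.

End probability_of_measure.

Lemma geometric_weights_sum (R : realType) (t : R) : (0 < t < 1)%R ->
  \sum_(0 <= n <oo) ((1 - t) * t ^+ n)%:E = 1%:E :> \bar R.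
Proof.
move=> /andP[t0 t1].
have tn : (`|t| < 1)%R by rewrite ger0_norm ?ltW.
have cv := @cvg_geometric_series R (1 - t)%R t tn.
rewrite divff ?subr_eq0 ?gt_eqF// in cv.
apply/cvg_lim => //.
rewrite (_ : (fun _ => _) = EFin \o series (geometric (1 - t)%R t)).
  exact/cvg_EFin/cv/nearW.
by apply/funext => n /=; rewrite sumEFin.
Qed.

Lemma nneseries_ge_term (R : realType) (u : nat -> \bar R) (n : nat) :
  (forall k, 0 <= u k) -> u n <= \sum_(0 <= k <oo) u k.
Proof.
move=> u0; apply: (le_trans _ (@nneseries_lim_ge _ u xpredT 0 n.+1 _)) => //.
by rewrite big_nat_recr//= leeDr// sume_ge0.
Qed.

Section mixture.
Context (d : measure_display) (Y : measurableType d) (R : realType).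
Variables (mu : {measure set Y -> \bar R}) (w : nat -> R) (f : nat -> Y -> R).
Hypotheses (w0 : forall n, (0 <= w n)%R)
  (w1 : \sum_(0 <= n <oo) (w n)%:E = 1)
  (fdens : forall n, is_density mu (f n)).

Let S y := \sum_(0 <= n <oo) (w n * f n y)%:E.

(** [fine] sends +oo to 0, which alters the series on a null set only. *)
Definition mixture (y : Y) : R := fine (S y).

Let wf0 n y : 0 <= (w n * f n y)%:E.
Proof. by have [_ f0 _] := fdens n; rewrite lee_fin mulr_ge0. Qed.

Let S0 y : 0 <= S y. Proof. exact: nneseries_ge0. Qed.

Let mwf n : measurable_fun [set: Y] (fun y : Y => (w n * f n y)%:E : \bar R).
Proof. by apply/measurable_EFinP/measurable_funM => //; have [] := fdens n. Qed.

Let mS : measurable_fun setT S.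
Proof. by apply: ge0_emeasurable_sum => // k x _ _. Qed.

Let intS : \int[mu]_y S y = 1.
Proof.
rewrite integral_nneseries// -w1; apply: eq_eseriesr => n _.
have [mf f0 f1] := fdens n.
under eq_integral do rewrite EFinM.
rewrite ge0_integralZl//; first by rewrite f1 mule1.
- exact/measurable_EFinP.
- by move=> y _; rewrite lee_fin.
- by rewrite lee_fin.
Qed.

Lemma mixtureE : {ae mu, forall y, (mixture y)%:E = S y}.
Proof.
have iS : mu.-integrable setT S.
  apply/integrableP; split => //.
  by under eq_integral do rewrite gee0_abs//; rewrite intS ltry.
by apply: filterS (integrable_ae measurableT iS) => y /(_ Logic.I) ?; rewrite fineK.
Qed.

Lemma mixture_density : is_density mu mixture.
Proof.
have mm : measurable_fun setT mixture.
  by apply: measurableT_comp mS => //; exact: fine_measurable.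
split => //; first by move=> y; rewrite fine_ge0.
rewrite -intS; apply: ae_eq_integral => //; first exact/measurable_EFinP.
by apply: filterS mixtureE => y.
Qed.

Lemma mixture_ge : {ae mu, forall y, forall n, (w n * f n y <= mixture y)%R}.
Proof.
apply: filterS mixtureE => y mE n; rewrite -lee_fin mE.
exact: (@nneseries_ge_term _ (fun k => (w k * f k y)%:E)).
Qed.

(** With the full power set as sigma-algebra, Dirac masses and their sums raise no measurability
    question. *)
Local Notation fspace := (@g_sigma_algebraType (Y -> R) setT).

Let mfspace (B : set fspace) : measurable B.
Proof. exact: sub_sigma_algebra. Qed.

Let nu := mseries (fun n => mscale (NngNum (w0 n)) (\d_(f n : fspace))) 0.

Let nuT : nu setT = 1.
Proof.
rewrite -w1 /nu /= /mseries; apply: eq_eseriesr => n _.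
by rewrite /= /mscale/= diracT mule1.
Qed.

Lemma mixture_closed (A : set (Y -> R)) : mixture_convex mu A ->
  (forall n, A (f n)) -> A mixture.
Proof.
move=> [_ Acvx] Af.
pose B : set fspace := range (f : nat -> fspace).
have dB n : \d_(f n : fspace) B = 1 :> \bar R.
  by rewrite diracE mem_set//; exists n.
apply: (Acvx setT (prob_of nuT : probability _ _) B) => //.
- by move=> _ [n _ <-].
- rewrite -w1 /prob_of /nu /= /mseries; apply: eq_eseriesr => n _.
  by rewrite /= /mscale/= dB mule1.
- move=> _ U mU.
  (* Evaluation is jointly measurable over a countable range: the preimage of [U] is a countable
     union of rectangles. *)
  rewrite (_ : _ `&` _ = \bigcup_n ([set f n : fspace] `*` (f n @^-1` U))).
    apply: bigcup_measurable => n _; apply: measurableX => //.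
    by rewrite -[X in measurable X]setTI; have [+ _ _] := fdens n; exact.
  apply/seteqP; split.
  + by move=> [h y] [[/= [n _ <-] _] Uy]; exists n.
  + by move=> [h y] [n _ [/= -> Uy]]; split => //; split => //; exists n.
- exact: mixture_density.
- apply: filterS mixtureE => y ->.
  have mev : measurable_fun B (fun h : fspace => (h y)%:E) by move=> _ U _.
  have ev0 (h : fspace) : B h -> 0 <= (h y)%:E.
    by move=> [n _ <-]; rewrite lee_fin; have [] := fdens n.
  rewrite (_ : integral _ _ _ = \int[nu]_(h in B) (h y)%:E)//.
  rewrite ge0_integral_measure_series//; apply: eq_eseriesr => n _.
  rewrite ge0_integral_mscale// integral_dirac// dB mul1e.
  by rewrite -EFinM.
Qed.

End mixture.

(** Convexity enters the estimates only through this domination of every component by the mixture.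
    The ratio [t] stays free: the moment bound takes 1/2, the minimax argument adapts it to the
    allowed error. *)
Lemma geometric_mixture (d : measure_display) (Y : measurableType d)
    (R : realType) (mu : {measure set Y -> \bar R}) (A : set (Y -> R))
    (f : nat -> Y -> R) (t : R) :
  mixture_convex mu A -> (forall n, A (f n)) -> (0 < t < 1)%R ->
  exists2 g, A g &
    {ae mu, forall y, forall n, ((1 - t) * t ^+ n * f n y <= g y)%R}.
Proof.
move=> Acvx Af t01; have /andP[t0 t1] := t01.
have w0 n : (0 <= (1 - t) * t ^+ n)%R.
  by rewrite mulr_ge0 ?subr_ge0 ?exprn_ge0// ltW.
have fd n : is_density mu (f n) by apply: Acvx.1.
have w1 := geometric_weights_sum t01.
exists (mixture (fun n => (1 - t) * t ^+ n)%R f).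
  exact: mixture_closed Acvx Af.
exact: mixture_ge.
Qed.

(** * The truncated logarithm *)

Section truncated_log.
Context {R : realType}.
Implicit Types (L a b l x y : R).
Local Open Scope ring_scope.

(** For x > 0 this is the minimum of - ln x and L; it takes the value L at 0. *)
Definition nlogT L x : R := - ln (Num.max x (expR (- L))).

Definition logp x : R := ln (Num.max x 1).

Lemma logp_ge0 x : 0 <= logp x.
Proof. by rewrite ln_ge0// le_max lexx orbT. Qed.

Let maxexp_gt0 L x : 0 < Num.max x (expR (- L)).
Proof. by rewrite lt_max expR_gt0 orbT. Qed.

Lemma nlogT_le L x : nlogT L x <= L.
Proof.
by rewrite /nlogT lerNl -[leLHS]expRK ler_ln ?posrE ?expR_gt0// le_max lexx orbT.
Qed.

Lemma nlogT_homo x : {homo nlogT ^~ x : a b / a <= b}.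
Proof.
move=> a b ab; rewrite /nlogT lerN2 ler_ln ?posrE// ge_max !le_max lexx /=.
by rewrite ler_expR lerN2 ab orbT.
Qed.

Lemma nlogT_anti L x y : x <= y -> nlogT L y <= nlogT L x.
Proof.
move=> xy; rewrite /nlogT lerN2 ler_ln ?posrE// ge_max !le_max lexx xy /=.
by rewrite orbT.
Qed.

Lemma nlogT_small a x : x <= expR (- a) -> nlogT a x = a.
Proof. by move=> xa; rewrite /nlogT max_r// expRK opprK. Qed.

Lemma nlogT_large a x : expR (- a) <= x -> nlogT a x = - ln x.
Proof. by move=> xa; rewrite /nlogT max_l. Qed.

Lemma nlogT_ge_logp L x : 0 <= L -> - logp x <= nlogT L x.
Proof.
move=> L0; rewrite /nlogT /logp lerN2 ler_ln ?posrE// ?lt_max ?ltr01 ?orbT//.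
rewrite ge_max !le_max lexx /=; apply/orP; right.
by rewrite -[leRHS]expR0 ler_expR oppr_le0.
Qed.

Lemma normr_nlogT_le L x : 0 <= L -> `|nlogT L x| <= L + logp x.
Proof.
move=> L0; have := nlogT_ge_logp x L0; have := nlogT_le L x.
have := logp_ge0 x; rewrite ler_norml => p0 TL pT; apply/andP; split; lra.
Qed.

Lemma nlogT_scale L l x : 0 <= l -> nlogT L (expR (- l) * x) <= nlogT L x + l.
Proof.
move=> l0; rewrite /nlogT.
have -> : - ln (Num.max x (expR (- L))) + l =
          - ln (expR (- l) * Num.max x (expR (- L))).
  by rewrite lnM ?posrE ?expR_gt0// expRK opprD opprK addrC.
rewrite lerN2 ler_ln ?posrE// ?mulr_gt0 ?expR_gt0//.
rewrite maxr_pMr ?expR_ge0// ge_max !le_max lexx /=; apply/orP; right.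
by rewrite -expRD ler_expR; lra.
Qed.

(* Passing from level [a] to level [b] only matters where [y < expR (- a)],
   which forces [x < expR (- (a - l))]; there the last summand is at least [l]. *)
Lemma nlogT_increment a b l x y : 0 <= l -> l < a -> a <= b ->
  expR (- l) * x <= y ->
  nlogT b y - nlogT a y <=
    nlogT b x - nlogT a x + l / (a - l) * (nlogT a x + logp x).
Proof.
move=> l0 la ab xy; have a0 : 0 <= a by lra.
have al0 : 0 < a - l by lra.
have c0 : 0 <= l / (a - l) by rewrite divr_ge0// ltW.
have Tx := nlogT_ge_logp x a0; have Txab : nlogT a x <= nlogT b x := nlogT_homo x ab.
have pos : 0 <= l / (a - l) * (nlogT a x + logp x) by rewrite mulr_ge0//; lra.
set q := l / (a - l) * _ in pos *.
have [ay|ya] := leP (expR (- a)) y.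
  have by_ : expR (- b) <= y by apply: le_trans ay; rewrite ler_expR lerN2.
  by rewrite (nlogT_large ay) (nlogT_large by_); lra.
rewrite (nlogT_small (ltW ya)).
have H1 := nlogT_anti b xy; have H2 := nlogT_scale b x l0.
have H3 := nlogT_le a x.
have xal : x <= expR (- (a - l)).
  rewrite -(ler_pM2l (expR_gt0 (- l))) -expRD (le_trans xy)//.
  by rewrite (_ : - l + - (a - l) = - a) ?ltW//; lra.
have H4 : a - l <= nlogT a x.
  rewrite -[X in X <= _](nlogT_small xal); apply: nlogT_homo; lra.
have : l <= q.
  rewrite /q -mulrA -[leLHS]mulr1 ler_wpM2l// mulrC ler_pdivlMr// mul1r.
  by have := logp_ge0 x; lra.
by lra.
Qed.

(** From expR (- u) >= 1 - u comes expR u <= 1 + u * expR u; this bound is used twice. *)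
Lemma expR_le_quad (u : R) : 0 <= u -> expR u <= 1 + u + u ^+ 2 * expR u.
Proof.
move=> u0; have := expR_ge1Dx (- u); rewrite expRN => H.
have e0 := expR_gt0 u.
have : (1 - u) * expR u <= 1 by rewrite -ler_pdivlMr// div1r.
by move=> ?; nra.
Qed.

(** Because (1 - u + u ^ 2) (1 + u) = 1 + u ^ 3 >= 1 and 1 + u <= expR u. *)
Lemma expRN_le_quad (u : R) : 0 <= u -> expR (- u) <= 1 - u + u ^+ 2.
Proof.
move=> u0; rewrite expRN -div1r ler_pdivrMr ?expR_gt0//.
have := expR_ge1Dx u => H.
have q0 : 0 <= 1 - u + u ^+ 2 by nra.
apply: (le_trans _ (ler_wpM2l q0 H)).
by rewrite (_ : _ * _ = 1 + u * u ^+ 2) ?lerDl ?mulr_ge0 ?sqr_ge0//; ring.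
Qed.

(** Below 1, x ^ a <= expR (- a z) with z = [nlogT L x] in [0, L], so the second-order error is at
    most a ^ 2 * L ^ 2. Above 1 the truncation is inactive and the larger power [a1] absorbs the
    error. *)
Lemma powR_le_quad (a a1 L x : R) : 0 < a -> 0 < a1 -> 2 * a <= a1 -> 0 <= L ->
  0 <= x ->
  x `^ a <= 1 - a * nlogT L x +
            a ^+ 2 * (L ^+ 2 + 16 / a1 ^+ 2 * (x `^ a1)).
Proof.
move=> a0 a10 aa1 L0 x0.
have ? : 0 <= a1 ^+ 2 by exact: sqr_ge0.
have K0 : 0 <= 16 / a1 ^+ 2 * (x `^ a1) by rewrite mulr_ge0 ?powR_ge0// divr_ge0.
have [x1|x1] := leP 1 x; last first.
  set z := nlogT L x; have zL : z <= L := nlogT_le L x.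
  have z0 : 0 <= z.
    have := nlogT_ge_logp x L0.
    by rewrite /logp (max_r (ltW x1)) ln1 oppr0.
  have xz : x <= expR (- z).
    by rewrite /z /nlogT opprK lnK ?posrE// le_max lexx.
  have : x `^ a <= expR (- (a * z)).
    rewrite -mulrN mulrC expRM.
    by rewrite ge0_ler_powR ?nnegrE ?expR_ge0// ltW.
  move=> /le_trans; apply.
  apply: (le_trans (expRN_le_quad _)); first by rewrite mulr_ge0// ltW.
  have zL2 : z ^+ 2 <= L ^+ 2 by rewrite lerXn2r ?nnegrE.
  rewrite exprMn lerD2l ler_wpM2l ?sqr_ge0//.
  by lra.
have xgt0 : 0 < x by lra.
have eL : expR (- L) <= x.
  by apply: le_trans x1; rewrite -[leRHS]expR0 ler_expR oppr_le0.
rewrite (nlogT_large eL); set t := ln x.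
have t0 : 0 <= t by rewrite ln_ge0.
have xE b : x `^ b = expR (b * t) by rewrite /powR gt_eqF.
rewrite !xE; apply: le_trans (expR_le_quad _) _; first by rewrite mulr_ge0// ltW.
suff : (a * t) ^+ 2 * expR (a * t) <=
       a ^+ 2 * (16 / a1 ^+ 2 * expR (a1 * t)).
  have : 0 <= a ^+ 2 * L ^+ 2 by rewrite mulr_ge0 ?sqr_ge0.
  by rewrite mulrDr; lra.
rewrite exprMn -[leLHS]mulrA ler_wpM2l ?sqr_ge0//.
(* Source of the constant 16: v ^ 2 <= expR (2 v) and a t <= a1 t / 2 = 2 v, so v ^ 2 * expR (a t)
   <= expR (4 v) = expR (a1 t). *)
set v := a1 * t / 4; have v0 : 0 <= v by rewrite divr_ge0 ?mulr_ge0// ltW.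
have tv : t = 4 / a1 * v by rewrite /v; field; rewrite gt_eqF.
have vexp : v ^+ 2 <= expR (2 * v).
  have /ltW H := expR_gt0 v; have := expR_ge1Dx v.
  rewrite mulrC expRM_natr => {}H; rewrite lerXn2r ?nnegrE ?expR_ge0//; lra.
have -> : t ^+ 2 = 16 / a1 ^+ 2 * v ^+ 2.
  by rewrite tv; field; rewrite gt_eqF.
rewrite -[leLHS]mulrA ler_wpM2l ?divr_ge0//.
apply: (le_trans (ler_wpM2r (expR_ge0 _) vexp)).
rewrite -expRD ler_expR /v.
have : 2 * a * t <= a1 * t by rewrite ler_wpM2r.
by lra.
Qed.

End truncated_log.

(** * Families of likelihood ratios under a probability *)

Lemma ae_le_Rintegral (d : measure_display) (T : measurableType d)
    (R : realType) (mu : {measure set T -> \bar R}) (f g : T -> R) :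
  mu.-integrable setT (EFin \o f) -> mu.-integrable setT (EFin \o g) ->
  {ae mu, forall x, (f x <= g x)%R} ->
  (\int[mu]_x f x <= \int[mu]_x g x)%R.
Proof.
move=> If Ig fg; rewrite -subr_ge0 -RintegralB//.
have mf : measurable_fun setT f by apply/measurable_EFinP/measurable_int/If.
have mg : measurable_fun setT g by apply/measurable_EFinP/measurable_int/Ig.
(* g - f agrees almost everywhere with its positive part, whose integral is nonnegative. *)
rewrite /Rintegral (ae_eq_integral (fun x => (Num.max (g x - f x) 0)%:E)%R)//.
- by apply: fine_ge0; apply: integral_ge0 => x _; rewrite lee_fin le_max lexx orbT.
- exact/measurable_EFinP/measurable_funB.
- apply/measurable_EFinP/measurable_maxr; last exact: measurable_cst.
  exact: measurable_funB.
- by apply: filterS fg => x fgx _; rewrite max_l// subr_ge0.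
Qed.

Lemma integrable_ae_eq (d : measure_display) (T : measurableType d)
    (R : realType) (mu : {measure set T -> \bar R}) (g f : T -> \bar R) :
  measurable_fun setT f -> {ae mu, forall x, f x = g x} ->
  mu.-integrable setT g -> mu.-integrable setT f.
Proof.
move=> mf fg /integrableP[mg gfin]; apply/integrableP; split => //.
rewrite (ae_eq_integral (abse \o g))//; first exact: measurableT_comp.
- exact: measurableT_comp.
- by apply: filterS fg => x /= -> _.
Qed.

Lemma RintegralN (d : measure_display) (T : measurableType d)
    (R : realType) (mu : {measure set T -> \bar R}) (f : T -> R) :
  mu.-integrable setT (EFin \o f) ->
  (\int[mu]_x (- f x) = - \int[mu]_x f x)%R.
Proof.
move=> If; rewrite -(mulN1r (\int[mu]_x f x)%R) -RintegralZl//.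
by apply: eq_Rintegral => x _; rewrite mulN1r.
Qed.

Lemma Rintegral_probability_cst (d : measure_display) (T : measurableType d)
    (R : realType) (P : probability T R) (k : R) :
  (\int[P]_y k = k)%R.
Proof.
by rewrite Rintegral_cst// [X in fine X](probability_setT P) mulr1.
Qed.

Section likelihood_ratios.
Context d (T : measurableType d) (R : realType) (P : probability T R).
Local Open Scope ring_scope.

Definition meanT (L : R) (r : T -> R) : R := \int[P]_y nlogT L (r y).

Section one_ratio.
Variable r : T -> R.
Hypothesis mr : measurable_fun setT r.
Hypothesis ir : P.-integrable setT (EFin \o (logp \o r)).

Lemma measurable_nlogT L : measurable_fun setT (nlogT L \o r).
Proof.
apply: measurable_funN; apply: measurableT_comp; first exact: measurable_ln.
by apply: measurable_maxr => //; exact: measurable_cst.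
Qed.

Lemma integrable_nlogT L : 0 <= L ->
  P.-integrable setT (EFin \o (nlogT L \o r)).
Proof.
move=> L0; have := integrableD measurableT
  (finite_measure_integrable_cst P L measurableT) ir.
apply: le_integrable => //; first exact/measurable_EFinP/measurable_nlogT.
move=> y _ /=; rewrite lee_fin (le_trans (normr_nlogT_le _ L0))//.
by rewrite ler_norm.
Qed.

Lemma meanT_homo a b : 0 <= a -> a <= b -> meanT a r <= meanT b r.
Proof.
move=> a0 ab; have b0 := le_trans a0 ab.
apply: le_Rintegral => //; [exact: integrable_nlogT..|].
by move=> y _; exact: nlogT_homo.
Qed.

Lemma meanT_ge L : 0 <= L -> - (\int[P]_y logp (r y)) <= meanT L r.
Proof.
move=> L0; have /= <- := RintegralN ir.
apply: le_Rintegral => //; [|exact: integrable_nlogT|].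
  exact: (integrableN ir).
by move=> y _; exact: nlogT_ge_logp.
Qed.

(** Monotone convergence for [nlogT n + logp], which is nonnegative and increases with n; the bound
    on its means makes the limit [W] integrable. *)
Lemma integrable_ln_of_meanT (e : R) :
  (forall y, 0 <= r y) -> (forall L, 0 <= L -> meanT L r <= e) ->
  [/\ {ae P, forall y, 0 < r y}, P.-integrable setT (EFin \o (ln (R := R) \o r))
    & - e <= \int[P]_y ln (r y)].
Proof.
move=> r0 re.
pose Z (n : nat) y := (nlogT n%:R (r y) + logp (r y))%:E.
have mlogp : measurable_fun setT (logp \o r).
  by apply/measurable_EFinP/measurable_int/ir.
have mZ n : measurable_fun setT (Z n).
  by apply/measurable_EFinP/measurable_funD => //; exact: measurable_nlogT.
have Z0 n y : (0 <= Z n y)%E.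
  by rewrite lee_fin -lerBlDr sub0r nlogT_ge_logp.
have ndZ y : {homo Z^~ y : n m / (n <= m)%N >-> (n <= m)%E}.
  by move=> n m nm; rewrite lee_fin lerD2r nlogT_homo// ler_nat.
pose W y := limn (Z ^~ y).
have cvW y : Z ^~ y @ \oo --> W y by exact: ereal_nondecreasing_is_cvgn (ndZ y).
have mW : measurable_fun setT W.
  by apply: (emeasurable_fun_cvg Z) => // y _; exact: cvW.
have W0 y : (0 <= W y)%E.
  by apply: lime_ge; [exact: ereal_nondecreasing_is_cvgn (ndZ y)|exact: nearW].
pose C := e + \int[P]_y logp (r y).
have intZ n : (\int[P]_y Z n y <= C%:E)%E.
  have iT := integrable_nlogT (ler0n R n).
  rewrite /Z integralD_EFin// -[X in (X + _)%E]fineK ?integrable_fin_num//.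
  rewrite -[X in (_ + X)%E]fineK ?integrable_fin_num// -EFinD lee_fin.
  by rewrite /C lerD2r; exact: re.
have intW : (\int[P]_y W y <= C%:E)%E.
  have cv := cvg_monotone_convergence (mu := P) measurableT mZ
    (fun n y _ => Z0 n y) (fun y _ => ndZ y).
  rewrite -(cvg_lim _ cv)//; apply: lime_le; first by apply/cvg_ex; eexists; exact: cv.
  exact: nearW.
have iW : P.-integrable setT W.
  apply/integrableP; split => //.
  under eq_integral do rewrite gee0_abs//.
  by rewrite (le_lt_trans intW)// ltry.
have Wfin := integrable_ae measurableT iW.
(* Where r vanishes, [Z m] is at least m, so [W] would be infinite. *)
have rpos : {ae P, forall y, 0 < r y}.
  apply: filterS Wfin => y /(_ Logic.I) Wy.
  rewrite lt_neqAle r0 andbT; apply/negP => /eqP ry0.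
  have : (forall n : nat, n%:R%:E <= W y)%E.
    move=> n; apply: lime_ge; first exact: ereal_nondecreasing_is_cvgn (ndZ y).
    near=> m; rewrite /Z -ry0 nlogT_small ?expR_ge0// lee_fin.
    rewrite (@le_trans _ _ m%:R) ?lerDl ?logp_ge0// ler_nat.
    by near: m; exact: nbhs_infty_ge.
  move/(_ (Num.Def.archi_bound (fine (W y)))).
  rewrite -(fineK Wy) lee_fin leNgt archi_boundP//.
  by rewrite fine_ge0.
have WE : {ae P, forall y, (- ln (r y) + logp (r y))%:E = W y}.
  apply: filterS rpos => y ry; apply/esym/cvg_lim => //.
  (* Once n reaches |ln r|, the truncation is inactive and the sequence is constant. *)
  apply: cvg_near_cst; near=> n; rewrite /Z nlogT_large//.
  rewrite -[leRHS]lnK ?posrE// ler_expR lerNl.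
  by apply: le_trans (ler_norm _) _; near: n; exact: nbhs_infty_ger.
have mln : measurable_fun setT (ln (R := R) \o r).
  by apply: measurableT_comp => //; exact: measurable_ln.
have mWE : measurable_fun setT (fun y => (- ln (r y) + logp (r y))%:E).
  by apply/measurable_EFinP/measurable_funD => //; exact: measurable_funN.
have iWE : P.-integrable setT (fun y => (- ln (r y) + logp (r y))%:E).
  exact: integrable_ae_eq mWE WE iW.
have iln : P.-integrable setT (EFin \o (ln (R := R) \o r)).
  have := integrableB measurableT ir iWE.
  apply: eq_integrable => // y _ /=; rewrite -EFinB; congr EFin; ring.
split => //.
have iNln := integrableN iln.
rewrite lerNl; have /= <- := RintegralN iln.
rewrite -(lerD2r (\int[P]_y logp (r y))) -RintegralD//.
rewrite -/C -lee_fin /Rintegral fineK.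
  by rewrite (ae_eq_integral W)//; apply: filterS WE => y <- _.
by have := integrable_fin_num measurableT iWE.
Unshelve. all: by end_near. Qed.

End one_ratio.

(** * Families with dominating geometric mixtures *)

Section ratio_family.
Variable A : set (T -> R).
Hypothesis mA : forall r, A r -> measurable_fun setT r.
Hypothesis A0 : forall r, A r -> forall y, 0 <= r y.
Hypothesis mixA : forall (f : nat -> T -> R) (t : R),
  (forall n, A (f n)) -> 0 < t < 1 ->
  exists2 g, A g & {ae P, forall y, forall n, (1 - t) * t ^+ n * f n y <= g y}.

(** Otherwise some f_n has E(f_n ^ a_n) > 2 n, where a_n = 1 / (n + 2). The mixture g with weights 2
    ^ - (n + 1) then has E(g ^ a_n) >= n for all n, whereas one finite moment of g bounds these for
    all large n. *)
Lemma uniform_power_moment :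
  (forall r, A r -> exists2 a, 0 < a & (\int[P]_y (r y `^ a)%:E < +oo)%E) ->
  exists a M : R, [/\ 0 < a, a < 1 &
    forall r, A r -> (\int[P]_y (r y `^ a)%:E <= M%:E)%E].
Proof.
move=> Afin; apply: contrapT => noM.
pose a (n : nat) : R := n.+2%:R^-1.
have a0 n : 0 < a n by rewrite invr_gt0.
have a1 n : a n < 1 by rewrite invf_lt1// ltr1n.
have /choice[f fP] : forall n, exists r : T -> R, A r /\
    ((2 * n%:R)%:E < \int[P]_y (r y `^ a n)%:E)%E.
  move=> n; apply: contrapT => nof; apply: noM.
  exists (a n), (2 * n%:R); split => // r Ar; rewrite leNgt; apply/negP => lt.
  by apply: nof; exists r.
have half01 : is_true (0 < (2^-1 : R) < 1) by apply/andP; lra.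
have [g Ag fg] := mixA (fun n => (fP n).1) half01.
have mpow r (b : R) : A r -> measurable_fun setT (fun y => (r y `^ b)%:E).
  move=> Ar; apply/measurable_EFinP.
  exact: (measurableT_comp (measurable_powR b) (mA Ar)).
have gbig n : (n%:R%:E <= \int[P]_y (g y `^ a n)%:E)%E.
  have : (2^-1%:E * \int[P]_y (f n y `^ a n)%:E <= \int[P]_y (g y `^ a n)%:E)%E.
    rewrite -ge0_integralZl//.
    - apply: ae_ge0_le_integral => //.
      + by move=> y _; rewrite -EFinM lee_fin mulr_ge0// powR_ge0.
      + apply: emeasurable_funM => //; exact: mpow (fP n).1.
      + by move=> y _; rewrite lee_fin powR_ge0.
      + exact: mpow.
      + apply: filterS fg => y /(_ n) fgy _; rewrite -EFinM lee_fin.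
        have fy0 : 0 <= f n y by exact: A0 (fP n).1 _.
        have hn0 : (0 : R) <= (1 - 2^-1) * 2^-1 ^+ n.
          by apply: mulr_ge0; [lra|rewrite exprn_ge0// invr_ge0].
        apply: (@le_trans _ _ (((1 - 2^-1) * 2^-1 ^+ n * f n y) `^ a n)); last first.
          by rewrite ge0_ler_powR ?nnegrE ?(mulr_ge0 hn0 fy0) ?(A0 Ag)// ltW.
        (* The weight 2 ^ - (n + 1) raised to the power 1 / (n + 2) is at least 1 / 2; this is the
           factor 2 in the choice of [f]. *)
        rewrite powRM// ler_wpM2r ?powR_ge0//.
        rewrite (_ : (1 - 2^-1) * 2^-1 ^+ n = 2^-1 ^+ n.+1); last first.
          by rewrite exprS; field.
        rewrite -powR_mulrn// -powRrM.
        apply: (@le_trans _ _ (2^-1 `^ 1)); first by rewrite powRr1.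
        rewrite ger_powR//; first by apply/andP; lra.
        by rewrite /a ler_pdivrMr// mul1r ler_nat.
    - exact: mpow (fP n).1.
    - by move=> y _; rewrite lee_fin powR_ge0.
  apply: le_trans.
  have -> : n%:R%:E = (2^-1%:E * (2 * n%:R)%:E)%E :> \bar R.
    by rewrite -EFinM mulKf.
  by apply: lee_wpmul2l; [rewrite lee_fin invr_ge0|exact: ltW (fP n).2].
have [b b0 gb] := Afin _ Ag.
pose K := fine (\int[P]_y (g y `^ b)%:E).
have KE : (\int[P]_y (g y `^ b)%:E)%E = K%:E.
  by rewrite fineK// ge0_fin_numE// integral_ge0// => y _; rewrite lee_fin powR_ge0.
(* Pointwise g ^ a_n <= 1 + g ^ b, by comparing g with 1. *)
have gle n : a n <= b -> (\int[P]_y (g y `^ a n)%:E <= (1 + K)%:E)%E.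
  move=> anb; rewrite EFinD -KE.
  have -> : (1%:E + \int[P]_y (g y `^ b)%:E = \int[P]_y (1 + g y `^ b)%:E)%E.
    under [RHS]eq_integral do rewrite EFinD.
    rewrite ge0_integralD//; last first.
    - exact: mpow.
    - by move=> y _; rewrite lee_fin powR_ge0.
    by rewrite integral_cst// mul1e; congr (_ + _)%E; rewrite -(probability_setT P).
  apply: ge0_le_integral => //.
  - by move=> y _; rewrite lee_fin powR_ge0.
  - exact: mpow.
  - by apply/measurable_EFinP/measurable_funD => //; apply/measurable_EFinP/mpow.
  - move=> y _; rewrite lee_fin.
    have gy0 := A0 Ag y; have [gy1|gy1] := leP (g y) 1.
      rewrite (@le_trans _ _ 1) ?lerDl ?powR_ge0//.
      have <- : (1 : R) `^ a n = 1 by rewrite powR1.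
      by rewrite ge0_ler_powR ?nnegrE// ltW.
    by rewrite -[leLHS]add0r lerD// ler_powR// ltW.
(* n >= 1 / b gives a_n <= b, and n > 1 + K gives the contradiction. *)
pose n := maxn (Num.Def.archi_bound (1 + K)) (Num.Def.archi_bound b^-1).
have K0 : 0 <= K.
  by rewrite fine_ge0// integral_ge0// => y _; rewrite lee_fin powR_ge0.
have anb : a n <= b.
  rewrite /a -[leRHS]invrK lef_pV2 ?posrE ?invr_gt0//.
  apply: (le_trans (ltW (archi_boundP _))); first by rewrite invr_ge0 ltW.
  by rewrite ler_nat (leq_trans _ (leqW (leqnSn n)))// leq_maxr.
have := le_trans (gbig n) (gle n anb); rewrite lee_fin leNgt => /negP; apply.
apply: (lt_le_trans (archi_boundP _)); first by rewrite addr_ge0.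
by rewrite ler_nat leq_maxl.
Qed.

Variable C : R.
Hypothesis iA : forall r, A r -> P.-integrable setT (EFin \o (logp \o r)).
Hypothesis AC : forall r, A r -> \int[P]_y logp (r y) <= C.

(* [g] mixes near-minimisers [f i] of [meanT (L i.+1)] along a sequence of
   levels [L i] at which the infimum [G] of [meanT] is within [eta * h ^+ i]
   of its supremum.  Going from level [L i] to [L i.+1], [meanT _ g] grows at most as
   [meanT _ (f i)] does, up to an error made small by the choice of [L i], and
   this growth is small. *)
Lemma meanT_minimax (e1 e2 : R) : e1 < e2 ->
  (forall L, 0 <= L -> exists2 r, A r & meanT L r < e1) ->
  exists2 g, A g & forall L, 0 <= L -> meanT L g <= e2.
Proof.
move=> e12 Ae1.
have arith1 (x y u v w : R) : x <= w + v -> w - v <= y -> u <= v ->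
  x - y + u <= 3 * v by lra.
have arith2 (x y u v w : R) : y <= w + 2 * v + 6 * v * (1 - 2 * u) ->
  x - y <= 3 * v * (2 * u) -> x <= w + 2 * v + 6 * v * (1 - u) by lra.
pose G L := inf [set meanT L r | r in A].
have hasG L : 0 <= L -> has_inf [set meanT L r | r in A].
  move=> L0; split; first by have [r Ar _] := Ae1 L L0; exists (meanT L r), r.
  exists (- C) => _ [r Ar <-].
  by apply: le_trans (meanT_ge (mA Ar) (iA Ar) L0); rewrite lerN2 AC.
have G_le L r : 0 <= L -> A r -> G L <= meanT L r.
  by move=> L0 Ar; apply: ge_inf; [case: (hasG L L0)|exists r].
have G_homo a b : 0 <= a -> a <= b -> G a <= G b.
  move=> a0 ab; have b0 := le_trans a0 ab.
  apply: lb_le_inf; first by case: (hasG b b0).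
  move=> _ [r Ar <-]; apply: (le_trans (G_le _ _ a0 Ar)).
  by apply: meanT_homo => //; [exact: mA|exact: iA].
have G_e1 L : 0 <= L -> G L <= e1.
  by move=> L0; have [r Ar /ltW] := Ae1 L L0; apply: le_trans; exact: G_le.
pose GS := [set G L | L in [set L | 0 <= L]].
have hasGS : has_sup GS.
  by split; [exists (G 0), 0 => /=|exists e1 => _ [L /= L0 <-]; exact: G_e1].
pose V := sup GS.
have G_V L : 0 <= L -> G L <= V by move=> L0; apply: sup_upper_bound => //; exists L.
have V_e1 : V <= e1.
  by apply: ge_sup; [case: hasGS|move=> _ [L /= L0 <-]; exact: G_e1].
have V_adherent c : 0 < c -> exists L, 0 <= L /\ V - c < G L.
  by move=> c0; have [_ [L /= L0 <-] VL] := sup_adherent c0 hasGS; exists L.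
clearbody V.
pose h : R := 2^-1.
have h0 i : 0 < h ^+ i by rewrite exprn_gt0// invr_gt0.
have h1 i : h ^+ i <= 1 by rewrite exprn_ile1// /h; lra.
have h2 : 2 * h = 1 by rewrite /h divff.
clearbody h.
(* Two of the ten parts are spent in [start] and six over all the steps together, which stays below
   [e2]. *)
pose eta := (e2 - e1) / 10.
have eta0 : 0 < eta by rewrite divr_gt0// subr_gt0.
have etaE : 10 * eta = e2 - e1 by rewrite /eta; field.
clearbody eta.
have [D D0 DC] : exists2 D, 0 < D & e1 + eta + C <= D.
  exists (`|e1 + eta + C| + 1); first by rewrite ltr_wpDl.
  by rewrite (le_trans (ler_norm _))// lerDl.
(* Component 0 then has weight expR (- eta); [l i] below is minus the logarithm of the weight of
   component i. *)
pose t := 1 - expR (- eta).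
have t01 : 0 < t < 1.
  have := expR_gt0 (- eta); have : expR (- eta) < 1.
    by rewrite -[ltRHS]expR0 ltr_expR oppr_lt0.
  by rewrite /t => ? ?; apply/andP; lra.
have /andP[t0 t1] := t01.
pose l (i : nat) := eta - i%:R * ln t.
have lnt : ln t <= 0 by apply: ln_le0; exact: ltW.
have l0 i : 0 < l i.
  have : 0 <= i%:R * - ln t by rewrite mulr_ge0 ?oppr_ge0.
  by rewrite /l; lra.
have weightE i : (1 - t) * t ^+ i = expR (- l i).
  have -> : 1 - t = expR (- eta) by rewrite /t; ring.
  by rewrite /l opprB (addrC _ (- eta)) expRD expRM_natl lnK ?posrE.
have /choice[L1 L1P] : forall i, exists L, 0 <= L /\ V - eta * h ^+ i < G L.
  by move=> i; apply: V_adherent; rewrite mulr_gt0.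
(* A level L i >= K i makes the correction l i / (L i - l i) * D at most eta * h ^ i; the summand 1
   makes the levels unbounded. *)
pose K i := l i + l i * D / (eta * h ^+ i) + 1.
have K1 i : 1 <= K i.
  have : 0 <= l i * D / (eta * h ^+ i).
    exact: divr_ge0 (mulr_ge0 (ltW (l0 i)) (ltW D0)) (ltW (mulr_gt0 eta0 (h0 i))).
  by have := l0 i; rewrite /K; lra.
(* Partial sums, so that the levels are nondecreasing and each is at least [L1 i + K i]. *)
pose L i := \sum_(j < i.+1) (L1 j + K j).
have LK0 j : 0 <= L1 j + K j.
  by rewrite addr_ge0//; [case: (L1P j)|rewrite (le_trans _ (K1 j))].
have L_ge i : L1 i + K i <= L i.
  by rewrite /L big_ord_recr/= lerDr sumr_ge0.
have L0 i : 0 <= L i by rewrite sumr_ge0.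
have LS i : L i <= L i.+1 by rewrite [leRHS]/L big_ord_recr/= lerDl.
have L_i i : i%:R <= L i.
  elim: i => [//|i IH]; rewrite /L big_ord_recr/= -/(L i) -natr1 lerD//.
  by rewrite (le_trans (K1 i.+1))// lerDr; case: (L1P i.+1).
clearbody L.
have /choice[f fP] : forall i, exists r, A r /\
    meanT (L i.+1) r < G (L i.+1) + eta * h ^+ i.
  move=> i; have e0 : 0 < eta * h ^+ i by rewrite mulr_gt0.
  by have [_ [r Ar <-] rL] := inf_adherent e0 (hasG _ (L0 i.+1)); exists r.
have [g Ag fg] := mixA (fun n => (fP n).1) t01.
have ig := integrable_nlogT (mA Ag) (iA Ag).
have If i := integrable_nlogT (mA (fP i).1) (iA (fP i).1).
have f_small i : meanT (L i.+1) (f i) <= V + eta * h ^+ i.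
  by have [_ /ltW /le_trans] := fP i; apply; rewrite lerD2r G_V.
(* One eta pays for the weight expR (- eta) of component 0, the other for its near-minimality. *)
have start : meanT (L 0) g <= V + 2 * eta.
  have le1 : meanT (L 0) g <= meanT (L 0) (f 0%N) + eta.
    have -> : meanT (L 0) (f 0%N) + eta =
        \int[P]_y (nlogT (L 0) (f 0%N y) + eta).
      rewrite RintegralD//; [|exact: If|exact: finite_measure_integrable_cst].
      by rewrite Rintegral_probability_cst.
    apply: ae_le_Rintegral; first exact: ig.
      exact: (integrableD measurableT (If 0%N _ (L0 0%N))
        (finite_measure_integrable_cst P eta measurableT)).
    apply: filterS fg => y /(_ 0%N); rewrite weightE {1}/l mul0r subr0 => fgy.
    exact: le_trans (nlogT_anti _ fgy) (nlogT_scale _ _ (ltW eta0)).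
  have le2 : meanT (L 0) (f 0%N) <= meanT (L 1) (f 0%N).
    by apply: meanT_homo => //; [exact: mA (fP _).1|exact: iA (fP _).1].
  have le3 : meanT (L 1) (f 0%N) <= V + eta.
    by have := f_small 0%N; rewrite expr0 mulr1.
  move: le1 le2 le3; move: (meanT _ g) (meanT (L 0) (f 0%N)) (meanT (L 1) _).
  by move=> x y z; lra.
(* Three errors of size eta * h ^ i: [f i] is near-minimal at level L i.+1, the infimum at level L i
   is close to V, and [nlogT_increment] adds a correction. *)
have step i : meanT (L i.+1) g - meanT (L i) g <= 3 * eta * h ^+ i.
  have Li : l i < L i.
    suff : l i < K i by have := L_ge i; have [] := L1P i; lra.
    rewrite /K -addrA ltrDl; apply: ltr_wpDl => //.
    exact: divr_ge0 (mulr_ge0 (ltW (l0 i)) (ltW D0)) (ltW (mulr_gt0 eta0 (h0 i))).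
  pose c := l i / (L i - l i).
  have c0 : 0 <= c by apply: (divr_ge0 (ltW (l0 i))); rewrite subr_ge0 ltW.
  pose q y := nlogT (L i.+1) (f i y) - nlogT (L i) (f i y) +
    c * (nlogT (L i) (f i y) + logp (f i y)).
  have Ip := iA (fP i).1.
  have IB := integrableB measurableT (If i _ (L0 i.+1)) (If i _ (L0 i)).
  have ID := integrableD measurableT (If i _ (L0 i)) Ip.
  have IZ := integrableZl measurableT c ID.
  have int_q : \int[P]_y q y = meanT (L i.+1) (f i) - meanT (L i) (f i) +
      c * (meanT (L i) (f i) + \int[P]_y logp (f i y)).
    rewrite RintegralD// RintegralB//; [|exact: If..].
    by rewrite RintegralZl// RintegralD//; exact: If.
  have le_q : meanT (L i.+1) g - meanT (L i) g <= \int[P]_y q y.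
    rewrite /meanT -RintegralB//; [|exact: ig..].
    apply: ae_le_Rintegral.
    - exact: (integrableB measurableT (ig _ (L0 i.+1)) (ig _ (L0 i))).
    - exact: (integrableD measurableT IB IZ).
    apply: filterS fg => y /(_ i); rewrite weightE => fgy.
    by apply: nlogT_increment => //; exact: ltW.
  have f_homo := meanT_homo (mA (fP i).1) Ip (L0 i) (LS i).
  have f_large : V - eta * h ^+ i <= meanT (L i) (f i).
    apply: le_trans (G_le _ _ (L0 i) (fP i).1).
    have [L1i0 /ltW /le_trans] := L1P i; apply; apply: G_homo => //.
    by apply: le_trans (L_ge i); rewrite lerDl (le_trans _ (K1 i)).
  have eh : eta * h ^+ i <= eta by rewrite ler_piMr// ltW.
  have fD : meanT (L i) (f i) + \int[P]_y logp (f i y) <= D.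
    apply: le_trans DC; apply: lerD; last exact: AC (fP i).1.
    apply: (le_trans f_homo); apply: (le_trans (f_small i)).
    by rewrite lerD.
  have cD : c * D <= eta * h ^+ i.
    rewrite /c mulrAC ler_pdivrMr ?subr_gt0//.
    rewrite -ler_pdivrMl ?mulr_gt0// mulrC.
    have [L1i _] := L1P i; have := L_ge i; rewrite /K => LKi.
    by rewrite lerBrDl (le_trans _ LKi)// -addrA ler_wpDl// addrA lerDl.
  apply: (le_trans le_q); rewrite int_q.
  have cfD := le_trans (ler_wpM2l c0 fD) cD.
  rewrite -(mulrA 3); move: (f_small i) f_large cfD.
  exact: arith1.
(* The errors 3 * eta * h ^ i form a geometric series with h = 1 / 2. *)
have bound n : meanT (L n) g <= V + 2 * eta + 6 * eta * (1 - h ^+ n).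
  elim: n => [|n IH]; first by rewrite expr0 subrr mulr0 addr0.
  have := step n; rewrite (_ : h ^+ n = 2 * h ^+ n.+1) in IH *.
    exact: arith2 IH.
  by rewrite exprS mulrA h2 mul1r.
exists g => // B B0.
pose n := Num.Def.archi_bound B.
have Bn : B <= L n by apply: le_trans (L_i n); rewrite ltW// archi_boundP.
apply: (le_trans (meanT_homo (mA Ag) (iA Ag) B0 Bn)).
apply: (le_trans (bound n)).
have : 6 * eta * (1 - h ^+ n) <= 6 * eta.
  by apply: ler_piMr; [rewrite mulr_ge0// ltW|rewrite gerBl ltW].
by move: (_ * (1 - _)) => u; lra.
Qed.

(** A level provided by [meanT_minimax] yields a first-order gain b * e / 4 in [powR_le_quad]; b is
    so small that the second-order term takes back at most half of it. *)
Lemma power_moment_lt1 (e a M : R) : 0 < e -> 0 < a -> a < 1 ->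
  (forall r, A r -> (\int[P]_y (r y `^ a)%:E <= M%:E)%E) ->
  (forall r, A r -> P.-integrable setT (EFin \o (ln (R := R) \o r)) ->
    {ae P, forall y, 0 < r y} -> \int[P]_y ln (r y) <= - e) ->
  exists b eta : R, [/\ 0 < b, b < 1, 0 < eta &
    forall r, A r -> (\int[P]_y (r y `^ b)%:E <= (1 - eta)%:E)%E].
Proof.
move=> e0 a0 a1 AM Ae.
(* Otherwise some g in the family has E(- ln g) <= e / 2, against the lower bound e. *)
have [L L0 AL] : exists2 L, 0 <= L & forall r, A r -> e / 4 <= meanT L r.
  apply: contrapT => noL.
  have e42 : e / 4 < e / 2 by lra.
  have [L L0|g Ag gL] := meanT_minimax e42.
    apply: contrapT => nor; apply: noL; exists L => // r Ar.
    by rewrite leNgt; apply/negP => lt; apply: nor; exists r.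
  have [g0 ig] := integrable_ln_of_meanT (mA Ag) (iA Ag) (A0 Ag) gL.
  by have := Ae g Ag ig g0; lra.
pose W := L ^+ 2 + 16 / a ^+ 2 * `|M| + 1.
have W0 : 0 < W.
  rewrite /W; have : 0 <= L ^+ 2 by exact: sqr_ge0.
  have : 0 <= 16 / a ^+ 2 * `|M| by rewrite mulr_ge0 ?divr_ge0 ?sqr_ge0.
  by lra.
(* The first bound is the condition 2 * b <= a of [powR_le_quad]; the second gives b * W <= e /
   8. *)
pose b := Num.min (a / 2) (e / (8 * W)).
have b0 : 0 < b by rewrite lt_min !divr_gt0// mulr_gt0.
have ba : 2 * b <= a.
  by have : b <= a / 2 by [rewrite ge_min lexx]; lra.
have bW : b * W <= e / 8.
  have : b <= e / (8 * W) by rewrite ge_min lexx orbT.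
  move=> /(ler_wpM2r (ltW W0)) /le_trans; apply.
  by rewrite le_eqVlt; apply/orP; left; apply/eqP; field; rewrite gt_eqF.
exists b, (b * e / 8); split => //; first by lra.
  by rewrite divr_gt0// mulr_gt0.
move=> r Ar.
have mpow c : measurable_fun setT (fun y => r y `^ c).
  exact: (measurableT_comp (measurable_powR c) (mA Ar)).
have intpow : (\int[P]_y (r y `^ a)%:E)%E = (\int[P]_y (r y `^ a))%:E.
  rewrite /Rintegral fineK// ge0_fin_numE; first by rewrite (le_lt_trans (AM r Ar))// ltry.
  by apply: integral_ge0 => y _; rewrite lee_fin powR_ge0.
have ia : P.-integrable setT (EFin \o (fun y => r y `^ a)).
  apply/integrableP; split; first exact/measurable_EFinP.
  under eq_integral do rewrite gee0_abs ?lee_fin ?powR_ge0//.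
  by rewrite (le_lt_trans (AM r Ar))// ltry.
have Ma : \int[P]_y (r y `^ a) <= `|M|.
  by rewrite -lee_fin -intpow (le_trans (AM r Ar))// lee_fin ler_norm.
have iT := integrable_nlogT (mA Ar) (iA Ar) L0.
have ic (k : R) := finite_measure_integrable_cst P k measurableT.
pose q y := 1 - b * nlogT L (r y) + b ^+ 2 * (L ^+ 2 + 16 / a ^+ 2 * (r y `^ a)).
have i1 := integrableB measurableT (ic 1) (integrableZl measurableT b iT).
have i2 := integrableZl measurableT (16 / a ^+ 2) ia.
have i3 := integrableD measurableT (ic (L ^+ 2)) i2.
have i4 := integrableZl measurableT (b ^+ 2) i3.
have iq : P.-integrable setT (EFin \o q) := integrableD measurableT i1 i4.
have intq : \int[P]_y q y = 1 - b * meanT L r +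
    b ^+ 2 * (L ^+ 2 + 16 / a ^+ 2 * \int[P]_y (r y `^ a)).
  rewrite /q RintegralD// RintegralB//; [|exact: ic|exact: (integrableZl measurableT b iT)].
  rewrite RintegralZl// RintegralZl// RintegralD//; last exact: ic.
  by rewrite !Rintegral_probability_cst RintegralZl.
apply: (@le_trans _ _ (\int[P]_y q y)%:E).
  rewrite /Rintegral fineK ?integrable_fin_num//.
  apply: ge0_le_integral => //.
  - by move=> y _; rewrite lee_fin powR_ge0.
  - exact/measurable_EFinP.
  - exact: measurable_int iq.
  - by move=> y _; rewrite lee_fin; apply: powR_le_quad => //; exact: A0 Ar y.
rewrite lee_fin intq.
have H1 : b * (e / 4) <= b * meanT L r by rewrite ler_wpM2l ?AL// ltW.
have H2 : b ^+ 2 * (L ^+ 2 + 16 / a ^+ 2 * \int[P]_y (r y `^ a)) <= b * (e / 8).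
  rewrite expr2 -mulrA ler_wpM2l ?(ltW b0)//; apply: le_trans bW.
  rewrite ler_wpM2l ?(ltW b0)// /W.
  have : 16 / a ^+ 2 * \int[P]_y (r y `^ a) <= 16 / a ^+ 2 * `|M|.
    by rewrite ler_wpM2l// divr_ge0// sqr_ge0.
  by lra.
by lra.
Qed.

End ratio_family.

End likelihood_ratios.

(** * Kullback-Leibler divergence as an expectation under f0 *)

Section density_probability.
Context (d : measure_display) (Y : measurableType d) (R : realType).
Variables (mu : {measure set Y -> \bar R}) (f : Y -> R).

Definition density_prob (_ : is_density mu f) : set Y -> \bar R :=
  fun A => \int[mu]_(y in A) (f y)%:E.

Hypothesis fd : is_density mu f.

Let f_ge0 y : 0 <= (f y)%:E.
Proof. by rewrite lee_fin; case: fd. Qed.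

Let mf : measurable_fun setT (fun y => (f y)%:E).
Proof. by apply/measurable_EFinP; case: fd. Qed.

Let density_prob0 : density_prob fd set0 = 0.
Proof. exact: integral_set0. Qed.

Let density_prob_ge0 A : 0 <= density_prob fd A.
Proof. exact: integral_ge0. Qed.

Let density_prob_sigma_additive : semi_sigma_additive (density_prob fd).
Proof. exact: semi_sigma_additive_nng_induced. Qed.

HB.instance Definition _ := isMeasure.Build _ _ _ (density_prob fd)
  density_prob0 density_prob_ge0 density_prob_sigma_additive.

Let density_prob_setT : density_prob fd setT = 1.
Proof. by case: fd. Qed.

HB.instance Definition _ :=
  @Measure_isProbability.Build _ _ R (density_prob fd) density_prob_setT.

Lemma density_prob_dominates : density_prob fd `<< mu.
Proof.
apply/null_content_dominatesP => A mA muA0; apply: null_set_integral => //.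
exact: measurable_funTS.
Qed.

Lemma density_prob_gt0 : {ae density_prob fd, forall y, (0 < f y)%R}.
Proof.
have mN : measurable (f @^-1` [set 0%R]).
  by rewrite -[X in measurable X]setTI; case: fd => + _ _; apply.
exists (f @^-1` [set 0%R]); split => //.
- rewrite /= /density_prob.
  under eq_integral => y /[!inE] /= -> do [].
  exact: integral0.
- move=> y /= /negP; rewrite lt_neqAle; case: fd => _ -> _.
  by rewrite andbT negbK => /eqP.
Qed.

End density_probability.

Section change_of_variables.
Context (d : measure_display) (Y : measurableType d) (R : realType).
Variables (mu : {sigma_finite_measure set Y -> \bar R}) (f : Y -> R).
Hypothesis fd : is_density mu f.
Local Notation P := (density_prob fd).

(** The Radon-Nikodym derivative of P agrees almost everywhere with f, since both have the same
    integral over every measurable set. *)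
Let ge0_integral_density_prob (X : Y -> \bar R) :
  measurable_fun setT X -> (forall y, 0 <= X y) ->
  \int[mu]_y (X y * (f y)%:E) = \int[P]_y X y.
Proof.
move=> mX X0; have dom := density_prob_dominates fd.
have mf : measurable_fun setT (fun y => (f y)%:E).
  by apply/measurable_EFinP; case: fd.
rewrite -(Radon_Nikodym_SigmaFinite.change_of_variables dom)//.
have iRN := Radon_Nikodym_SigmaFinite.f_integrable dom.
have mRN := measurable_int _ iRN.
apply: ae_eq_integral => //; [exact: emeasurable_funM..|].
have : ae_eq mu setT (Radon_Nikodym_SigmaFinite.f P mu) (EFin \o f).
  apply: integral_ae_eq => // E _ mE.
  by rewrite -Radon_Nikodym_SigmaFinite.f_integral.
by apply: filterS => y + _ => /(_ Logic.I) ->.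
Qed.

Lemma integral_density_prob (X : Y -> \bar R) : measurable_fun setT X ->
  \int[mu]_y (X y * (f y)%:E) = \int[P]_y X y.
Proof.
move=> mX; have f0 y : 0 <= (f y)%:E by rewrite lee_fin; case: fd.
rewrite integralE [RHS]integralE; congr (_ - _).
- rewrite -ge0_integral_density_prob//; last exact: measurable_funepos.
  by apply: eq_integral => y _; rewrite !funeposE maxe_pMl// mul0e.
- rewrite -ge0_integral_density_prob//; last exact: measurable_funeneg.
  by apply: eq_integral => y _; rewrite !funenegE maxe_pMl// mul0e mulNe.
Qed.

End change_of_variables.

Lemma measurable_lne (R : realType) : measurable_fun [set: \bar R] (@lne R).
Proof.
rewrite (_ : @lne R = fun x => if x <= 0 then -oo else
    if x == +oo then +oo else (ln (fine x))%:E); last first.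
  by apply/funext => -[x| |]//=; rewrite leNye.
apply: (@measurable_fun_ifT _ _ _ _ (cst -oo) _ (fun x : \bar R => x <= 0)) => //.
  exact: measurable_fun_lee.
apply: (@measurable_fun_ifT _ _ _ _ (cst +oo) _ (fun x : \bar R => x == +oo)) => //.
  exact: measurable_fun_eqe.
apply/measurable_EFinP.
exact: (measurableT_comp (@measurable_ln R) (@fine_measurable R _ measurableT)).
Qed.

Lemma measurable_ratio (d : measure_display) (Y : measurableType d)
    (R : realType) (f g : Y -> R) :
  measurable_fun setT f -> measurable_fun setT g -> (forall y, 0 <= g y)%R ->
  measurable_fun setT (ratio f g).
Proof.
move=> mf mg g0; apply: emeasurable_funM; first exact/measurable_EFinP.
(* In \bar R the inverse of 0 is +oo; elsewhere it is the power -1, known to be measurable. *)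
rewrite (_ : (fun _ => _) =
  fun y => if g y == 0%R then +oo else (g y `^ (-1))%:E); last first.
  by apply/funext => y; rewrite inver powR_inv1.
apply: (@measurable_fun_ifT _ _ _ _ (cst +oo) _ (fun y => g y == 0%R)) => //.
  exact: measurable_fun_eqr.
by apply/measurable_EFinP/(measurableT_comp (measurable_powR _)).
Qed.

(** * Likelihood ratios against the minimizer *)

Section misspecified_bounds.
Context (d : measure_display) (Y : measurableType d) (R : realType).
Variables (mu : {sigma_finite_measure set Y -> \bar R}) (f0 fstar : Y -> R).
Hypotheses (f0d : is_density mu f0) (fsd : is_density mu fstar).
Hypothesis KLfin : KL mu f0 fstar \is a fin_num.
Hypothesis f0fs : \int[mu]_y ratio f0 fstar y < +oo.
Local Notation P := (density_prob f0d).

(** A real-valued form of [ratio], equal to it where g is positive; division by 0 gives 0. *)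
Definition lratio (f g : Y -> R) (y : Y) : R := (f y / g y)%R.

Let loglr y : R := ln (lratio f0 fstar y).

Lemma measurable_lratio (f g : Y -> R) :
  is_density mu f -> is_density mu g -> measurable_fun setT (lratio f g).
Proof.
move=> [mf _ _] [mg g0 _].
rewrite (_ : lratio f g = fun y => f y * g y `^ (-1))%R; last first.
  by apply/funext => y; rewrite powR_inv1.
by apply: measurable_funM => //; apply: (measurableT_comp (measurable_powR _)).
Qed.

Let mratio (f g : Y -> R) :
  is_density mu f -> is_density mu g -> measurable_fun setT (ratio f g).
Proof. by move=> [mf _ _] [mg g0 _]; exact: measurable_ratio. Qed.

Let ratio_EFin (f g : Y -> R) y : (0 < g y)%R ->
  ratio f g y = (lratio f g y)%:E.
Proof. by move=> g0; rewrite /ratio inver gt_eqF. Qed.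

Let ae_P (Q : Y -> Prop) : {ae mu, forall y, Q y} -> {ae P, forall y, Q y}.
Proof.
move=> [N [mN N0 QN]]; exists N; split => //.
by have /null_content_dominatesP := density_prob_dominates f0d; exact.
Qed.

Let f0_gt0 : {ae P, forall y, (0 < f0 y)%R} := density_prob_gt0 f0d.

(** f0 / fstar has a finite integral, so it is finite almost everywhere, but it is +oo where fstar =
    0 < f0. *)
Lemma fstar_gt0 : {ae P, forall y, (0 < fstar y)%R}.
Proof.
have ir : mu.-integrable setT (ratio f0 fstar).
  apply/integrableP; split; first exact: mratio.
  under eq_integral => y _.
    rewrite gee0_abs; first over.
    rewrite /ratio mule_ge0// ?inve_ge0// lee_fin.
      by case: f0d.
    by case: fsd.
  exact: f0fs.
have := integrable_ae measurableT ir => /ae_P; apply: filterS2 f0_gt0.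
move=> y y0 /(_ Logic.I); rewrite lt_neqAle; case: fsd => _ -> _.
rewrite andbT; apply: contraL => /eqP fsy.
by rewrite /ratio -fsy inve0 gt0_muley.
Qed.

Lemma hstarE (a : R) (f : Y -> R) : is_density mu f -> a != 0%R ->
  hstar mu f0 fstar a f = \int[P]_y (lratio f fstar y `^ a)%:E.
Proof.
move=> fd a0; rewrite /hstar (negbTE a0) /expect0 integral_density_prob.
  have mp : measurable_fun setT (fun y => ratio f fstar y `^ a).
    exact: (measurableT_comp (measurable_poweR a) (mratio fd fsd)).
  apply: ae_eq_integral => //.
    apply/measurable_EFinP.
    exact: (measurableT_comp (measurable_powR a) (measurable_lratio fd fsd)).
  by apply: filterS fstar_gt0 => y y0 _; rewrite ratio_EFin// poweR_EFin.
exact: (measurableT_comp (measurable_poweR a) (mratio fd fsd)).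
Qed.

Lemma expect0_ratioE (f : Y -> R) : is_density mu f ->
  expect0 mu f0 (ratio f fstar) = \int[P]_y (lratio f fstar y `^ 1)%:E.
Proof.
move=> fd; rewrite -hstarE ?oner_eq0// /hstar oner_eq0; congr integral.
apply/funext => y; rewrite poweRe1// /ratio mule_ge0 ?inve_ge0// lee_fin.
  by case: fd.
by case: fsd.
Qed.

Let loge (f : Y -> R) y := lne (ratio f0 f y).

Let mloge f : is_density mu f -> measurable_fun setT (loge f).
Proof.
by move=> fd; exact: (measurableT_comp (@measurable_lne R) (mratio f0d fd)).
Qed.

Let KLE f : is_density mu f -> KL mu f0 f = \int[P]_y loge f y.
Proof. by move=> fd; apply: integral_density_prob; exact: mloge. Qed.

Let loge_gt0 f y : (0 < f0 y)%R -> (0 < f y)%R ->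
  loge f y = (ln (lratio f0 f y))%:E.
Proof. by move=> y0 fy; rewrite /loge ratio_EFin// lne_EFin// divr_gt0. Qed.

Let loge_eq0 f y : (0 < f0 y)%R -> f y = 0%R -> loge f y = +oo.
Proof. by move=> y0 fy; rewrite /loge /ratio fy inve0 gt0_muley. Qed.

(** An inequality only, because f may put mass where f0 vanishes. *)
Lemma lratio_f0_integral f : is_density mu f ->
  \int[P]_y (lratio f f0 y)%:E <= 1.
Proof.
move=> fd; have [mf fge <-] := fd; have [mf0 f0ge _] := f0d.
have mr := measurable_lratio fd f0d.
rewrite -integral_density_prob; last exact/measurable_EFinP.
apply: ge0_le_integral => //.
- by move=> y _; rewrite -EFinM lee_fin mulr_ge0// divr_ge0.
- by apply: emeasurable_funM; exact/measurable_EFinP.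
- exact/measurable_EFinP.
- move=> y _; rewrite -EFinM lee_fin /lratio.
  by have [->|y0] := eqVneq (f0 y) 0%R; rewrite ?mulr0// divfK.
Qed.

Let integrable_lratio_f0 f : is_density mu f ->
  P.-integrable setT (EFin \o lratio f f0).
Proof.
move=> fd; apply/integrableP; split.
  exact/measurable_EFinP/measurable_lratio.
under eq_integral => y _.
  rewrite gee0_abs; first over.
  by rewrite lee_fin divr_ge0//; [case: fd|case: f0d].
by rewrite (le_lt_trans (lratio_f0_integral fd))// ltry.
Qed.

(** The negative part of ln (f0 / f) is at most f / f0, of mean at most 1. Hence a divergence is
    never -oo, and when it is below +oo the logarithm is integrable. *)
Let loge_negpart f : is_density mu f -> \int[P]_y (loge f)^\- y < +oo.
Proof.
move=> fd; apply: (@le_lt_trans _ _ 1); last by rewrite ltry.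
apply: le_trans (lratio_f0_integral fd); apply: ae_ge0_le_integral => //.
- exact/measurable_funeneg/mloge.
- by move=> y _; rewrite lee_fin divr_ge0//; [case: fd|case: f0d].
- exact/measurable_EFinP/measurable_lratio.
have [_ fge _] := fd.
apply: filterS f0_gt0 => y y0 _; rewrite funenegE.
have r0 : 0 <= (lratio f f0 y)%:E by rewrite lee_fin divr_ge0// ltW.
have := fge y; rewrite le_eqVlt => /predU1P[fy|fy].
  by rewrite loge_eq0//= ge_max r0 andbT leNye.
rewrite loge_gt0// ge_max r0 andbT -EFinN lee_fin -lnV ?posrE ?divr_gt0//.
rewrite invf_div; apply: le_trans (ltW (ln_sublinear _)) _ => //.
by rewrite divr_gt0.
Qed.

Let loge_negpart_fin f : is_density mu f ->
  \int[P]_y (loge f)^\- y \is a fin_num.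
Proof.
move=> fd; rewrite ge0_fin_numE ?loge_negpart//.
by apply: integral_ge0 => y _; exact: funeneg_ge0.
Qed.

Let integrable_loge f : is_density mu f -> KL mu f0 f < +oo ->
  P.-integrable setT (loge f).
Proof.
move=> fd; rewrite KLE// integralE lteBlDr ?loge_negpart_fin// addye; last first.
  by have := loge_negpart_fin fd; rewrite fin_numE => /andP[].
move=> pos; apply/integrableP; split; first exact: mloge.
rewrite -[X in integral _ _ X]/(abse \o loge f) fune_abse ge0_integralD//.
- by rewrite lte_add_pinfty// loge_negpart.
- exact/measurable_funepos/mloge.
- exact/measurable_funeneg/mloge.
Qed.

Let KL_fstar_lty : KL mu f0 fstar < +oo.
Proof. by rewrite ltey_eq KLfin. Qed.

Let loge_fstar : {ae P, forall y, (loglr y)%:E = loge fstar y}.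
Proof.
by apply: filterS2 f0_gt0 fstar_gt0 => y y0 fy; rewrite loge_gt0.
Qed.

Let measurable_loglr (f g : Y -> R) : is_density mu f -> is_density mu g ->
  measurable_fun setT (fun y => ln (lratio f g y)).
Proof.
by move=> fd gd; exact: (measurableT_comp (@measurable_ln R) (measurable_lratio fd gd)).
Qed.

Let integrable_loglr : P.-integrable setT (EFin \o loglr).
Proof.
apply: (@integrable_ae_eq _ _ _ _ (loge fstar)).
- exact/measurable_EFinP/measurable_loglr.
- exact: loge_fstar.
- exact: integrable_loge.
Qed.

Let KL_fstarE : KL mu f0 fstar = (\int[P]_y loglr y)%R%:E.
Proof.
rewrite KLE// /Rintegral fineK; last exact: integrable_fin_num.
apply: ae_eq_integral => //; first exact: mloge.
  exact/measurable_EFinP/measurable_loglr.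
by apply: filterS loge_fstar => y + _ => ->.
Qed.

Let logeE f y : (0 < f0 y)%R -> (0 < fstar y)%R -> (0 < f y)%R ->
  loge f y = (loglr y - ln (lratio f fstar y))%:E.
Proof.
move=> y0 sy fy; rewrite loge_gt0// /loglr /lratio !ln_div ?posrE//.
by congr EFin; ring.
Qed.

Lemma KLstarE f : is_density mu f ->
  {ae P, forall y, (0 < lratio f fstar y)%R} ->
  P.-integrable setT (EFin \o (fun y => ln (lratio f fstar y))) ->
  KLstar mu f0 fstar f = (- (\int[P]_y ln (lratio f fstar y)))%R%:E.
Proof.
move=> fd r0 ir; rewrite /KLstar KL_fstarE.
have -> : KL mu f0 f =
    (\int[P]_y loglr y - (\int[P]_y ln (lratio f fstar y)))%R%:E.
  rewrite -RintegralB//.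
  have ib := integrableB measurableT integrable_loglr ir.
  rewrite KLE// /Rintegral fineK; last exact: (integrable_fin_num measurableT ib).
  apply: ae_eq_integral => //; [exact: mloge|exact: measurable_int ib|].
  have [_ fge _] := fd.
  apply: filterS3 f0_gt0 fstar_gt0 r0 => y y0 sy ry _; apply: logeE => //.
  by rewrite -(pmulr_lgt0 _ (_ : 0 < (fstar y)^-1)%R) ?invr_gt0.
by rewrite -EFinB; congr EFin; ring.
Qed.

(** A finite [KLstar] makes ln (f0 / f) integrable, hence f positive almost surely; ln (f / fstar)
    is then a difference of two integrable logarithms. *)
Lemma integrable_ln_lratio f : is_density mu f ->
  KLstar mu f0 fstar f < +oo ->
  {ae P, forall y, (0 < lratio f fstar y)%R} /\
  P.-integrable setT (EFin \o (fun y => ln (lratio f fstar y))).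
Proof.
move=> fd; rewrite /KLstar lteBlDr// addye; last first.
  by move: KLfin; rewrite fin_numE => /andP[].
move=> /(integrable_loge fd) il.
have [_ fge _] := fd.
have f_gt0 : {ae P, forall y, (0 < f y)%R}.
  apply: filterS2 f0_gt0 (integrable_ae measurableT il) => y y0 /(_ Logic.I).
  rewrite lt_neqAle fge andbT; apply: contraL => /eqP fy.
  by rewrite loge_eq0.
split; first by apply: filterS2 fstar_gt0 f_gt0 => y ? ?; rewrite divr_gt0.
apply: integrable_ae_eq (integrableB measurableT integrable_loglr il).
  exact/measurable_EFinP/measurable_loglr.
apply: filterS3 f0_gt0 fstar_gt0 f_gt0 => y y0 sy fy.
by rewrite logeE//= -EFinB; congr EFin; ring.
Qed.

(** Bounds the mean of [logp] of f / fstar uniformly in f: in f / fstar = (f0 / fstar) (f / f0) the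
    first factor has an integrable logarithm, and ln x <= x handles the second. *)
Let C : R := (\int[P]_y `|loglr y| + 1)%R.

Let logp_le f : is_density mu f -> {ae P, forall y,
  (logp (lratio f fstar y) <= `|loglr y| + lratio f f0 y)%R}.
Proof.
move=> [_ fge _]; apply: filterS2 f0_gt0 fstar_gt0 => y y0 sy.
have r0 : (0 <= lratio f f0 y)%R by rewrite divr_ge0// ltW.
have [r1|r1] := leP (lratio f fstar y) 1%R.
  by rewrite /logp max_r// ln1 addr_ge0.
have fy : (0 < f y)%R.
  rewrite lt_neqAle fge andbT; apply: contraTneq r1 => fy.
  by rewrite /lratio -fy mul0r -leNgt.
rewrite /logp max_l ?(ltW r1)//.
have -> : ln (lratio f fstar y) = (loglr y + ln (lratio f f0 y))%R.
  by rewrite /loglr /lratio !ln_div ?posrE//; ring.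
by rewrite lerD ?ler_norm// ltW// ln_sublinear// divr_gt0.
Qed.

Lemma logp_lratio f : is_density mu f ->
  P.-integrable setT (EFin \o (@logp R \o lratio f fstar)) /\
  (\int[P]_y logp (lratio f fstar y) <= C)%R.
Proof.
move=> fd; have iB := integrableD measurableT
  (integrable_abse integrable_loglr) (integrable_lratio_f0 fd).
have mlogp : measurable_fun setT (@logp R \o lratio f fstar).
  apply: (measurableT_comp (@measurable_ln R)).
  by apply: measurable_maxr; [exact: measurable_lratio|exact: measurable_cst].
have le_int : \int[P]_y (logp (lratio f fstar y))%:E <=
              \int[P]_y (`|loglr y| + lratio f f0 y)%:E.
  apply: ae_ge0_le_integral => //.
  - by move=> y _; rewrite lee_fin logp_ge0.
  - exact/measurable_EFinP.
  - move=> y _; rewrite lee_fin addr_ge0// divr_ge0//; first by case: fd.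
    by case: f0d.
  - exact: measurable_int iB.
  - by apply: filterS (logp_le fd) => y + _; rewrite lee_fin.
have ip : P.-integrable setT (EFin \o (@logp R \o lratio f fstar)).
  apply/integrableP; split; first exact/measurable_EFinP.
  under eq_integral do rewrite gee0_abs ?lee_fin ?logp_ge0//.
  exact: le_lt_trans le_int (integrable_lty measurableT iB).
split => //; apply: (@le_trans _ _ (\int[P]_y (`|loglr y| + lratio f f0 y))%R).
  by apply: fine_le => //; exact: integrable_fin_num.
rewrite RintegralD//; last 2 first.
- exact: integrable_abse integrable_loglr.
- exact: integrable_lratio_f0.
rewrite lerD2l -lee_fin /Rintegral fineK ?lratio_f0_integral//.
by apply: integrable_fin_num => //; exact: integrable_lratio_f0.
Qed.

(* Integrates the tangent-line bound [expR (a * (x + c)) >= 1 + a * (x + c)]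
   at [x = ln (f / fstar)]. *)
Lemma hstar_ge (f : Y -> R) (a c : R) : is_density mu f ->
  (0 <= a <= 1)%R -> (0 <= c)%R -> KLstar mu f0 fstar f <= c%:E ->
  (expR (- c))%:E <= hstar mu f0 fstar a f.
Proof.
move=> fd /andP[a0 a1] c0 Kc.
have [a_eq0|an0] := eqVneq a 0%R.
  by rewrite /hstar a_eq0 eqxx lee_fin -[leRHS]expR0 ler_expR oppr_le0.
have [r0 ir] := integrable_ln_lratio fd (le_lt_trans Kc (ltry _)).
move: Kc; rewrite KLstarE// lee_fin => Kc.
rewrite hstarE//.
have ic (k : R) := finite_measure_integrable_cst P k measurableT.
have iD := integrableD measurableT ir (ic c).
have iZ := integrableZl measurableT a iD.
have i1 := integrableD measurableT (ic 1%R) iZ.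
have i2 := integrableZl measurableT (expR (- (a * c))) i1.
(* The mean of [q] is at least expR (- (a * c)), because ln (f / fstar) has mean at least - c; and a
   <= 1 turns this into expR (- c). *)
pose q y := (expR (- (a * c)) * (1 + a * (ln (lratio f fstar y) + c)))%R.
have mpow : measurable_fun setT (fun y => (lratio f fstar y `^ a)%:E).
  apply/measurable_EFinP.
  exact: (measurableT_comp (measurable_powR a) (measurable_lratio fd fsd)).
apply: (@le_trans _ _ (\int[P]_y q y)%R%:E).
  rewrite /q RintegralZl// RintegralD//; last exact: ic.
  rewrite RintegralZl// RintegralD//; last exact: ic.
  rewrite !Rintegral_probability_cst lee_fin.
  apply: (@le_trans _ _ (expR (- (a * c)))).
    by rewrite ler_expR lerN2 ler_piMl.
  by rewrite ler_peMr ?expR_ge0// lerDl mulr_ge0//; lra.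
have [hfin|] := boolP (\int[P]_y (lratio f fstar y `^ a)%:E \is a fin_num);
  last first.
  rewrite ge0_fin_numE; last by apply: integral_ge0 => y _; rewrite lee_fin powR_ge0.
  by rewrite -leNgt leye_eq => /eqP ->; rewrite leey.
have ip : P.-integrable setT (EFin \o (fun y => lratio f fstar y `^ a)%R).
  apply/integrableP; split => //.
  under eq_integral do rewrite gee0_abs ?lee_fin ?powR_ge0//.
  by rewrite ltey_eq hfin.
rewrite -[leRHS]fineK// lee_fin; apply: ae_le_Rintegral => //.
apply: filterS r0 => y ry; rewrite /q /powR gt_eqF//.
apply: le_trans (ler_wpM2l (expR_ge0 _) (expR_ge1Dx _)) _.
by rewrite -expRD ler_expR; lra.
Qed.

(** The ratios f / fstar form a family as above: dividing by fstar preserves domination by a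
    mixture, and [logp_lratio] supplies the uniform bound on [logp]. *)
Lemma hstar_uniformly_separated_of_KL (A : set (Y -> R)) :
  mixture_convex mu A -> KL_separated mu f0 fstar A ->
  (forall f, A f -> exists2 a : R, (0 < a)%R &
    \int[P]_y (lratio f fstar y `^ a)%:E < +oo) ->
  hstar_uniformly_separated mu f0 fstar A.
Proof.
move=> Acvx [eps eps0 Aeps] Afin.
have Ad f : A f -> is_density mu f by exact: Acvx.1.
have [_ fsge _] := fsd.
pose B := [set lratio f fstar | f in A].
have mB r : B r -> measurable_fun setT r.
  by move=> [f Af <-]; apply: measurable_lratio => //; exact: Ad.
have B0 r : B r -> forall y, (0 <= r y)%R.
  by move=> [f /Ad[_ fge _] <-] y; rewrite divr_ge0.
have mixB (r : nat -> Y -> R) (t : R) : (forall n, B (r n)) -> (0 < t < 1)%R ->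
    exists2 g, B g &
      {ae P, forall y, forall n, ((1 - t) * t ^+ n * r n y <= g y)%R}.
  move=> Br t01.
  have /choice[f fP] : forall n, exists f, A f /\ lratio f fstar = r n.
    by move=> n; have [f Af fr] := Br n; exists f.
  have [g Ag fg] := geometric_mixture Acvx (fun n => (fP n).1) t01.
  exists (lratio g fstar); first by exists g.
  apply: filterS (ae_P fg) => y gy n; rewrite -(fP n).2 /lratio mulrA.
  by rewrite ler_wpM2r ?invr_ge0.
have Bfin r : B r -> exists2 a : R, (0 < a)%R & \int[P]_y (r y `^ a)%:E < +oo.
  by move=> [f Af <-]; exact: Afin.
have [a [M [a0 a1 BM]]] := uniform_power_moment mB B0 mixB Bfin.
have iB r : B r -> P.-integrable setT (EFin \o (@logp R \o r)).
  by move=> [f /Ad /logp_lratio[? _] <-].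
have BC r : B r -> (\int[P]_y logp (r y) <= C)%R.
  by move=> [f /Ad /logp_lratio[_ ?] <-].
have Beps r : B r -> P.-integrable setT (EFin \o (@ln R \o r)) ->
    {ae P, forall y, (0 < r y)%R} -> (\int[P]_y ln (r y) <= - eps)%R.
  move=> [f Af <-] il r0; rewrite lerNr -lee_fin -KLstarE//; last exact: Ad.
  by apply: ltW; apply: lt_le_trans Aeps _; apply: ereal_inf_lbound; exists f.
have [b [eta [b0 b1 eta0 Bb]]] :=
  power_moment_lt1 mB B0 mixB iB BC eps0 a0 a1 BM Beps.
(* Halving gives strictness: 1 - eta < 1 - eta / 2 <= expR (- (eta / 2)). *)
exists b, (eta / 2)%R; split; [by rewrite b0|by rewrite divr_gt0|].
apply: (@le_lt_trans _ _ (1 - eta)%R%:E).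
  apply: ge_ereal_sup => _ [f Af <-]; rewrite hstarE ?gt_eqF//; last exact: Ad.
  by apply: Bb; exists f.
rewrite lte_fin; apply: lt_le_trans (expR_ge1Dx _).
by lra.
Qed.

End misspecified_bounds.

(** The set of all densities is itself mixture-convex, since the closure condition only asks
    densities g to belong. *)
Lemma mixture_hull_density (d : measure_display) (Y : measurableType d)
    (R : realType) (mu : {measure set Y -> \bar R}) (F : set (Y -> R)) :
  F `<=` is_density mu -> mixture_hull mu F `<=` is_density mu.
Proof. by move=> Fd f; apply; split=> //; split. Qed.

(** The equivalence with (i) asks for E(f / fstar) < +oo on [A] itself, as finiteness on [F0] need
    not pass to countable mixtures. From (ii) to (iii), condition (ii) already supplies a finite
    moment. *)
Theorem proposition2 (d : measure_display) (Y : measurableType d) (R : realType)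
  (mu : {sigma_finite_measure set Y -> \bar R})
  (F0 : set (Y -> R)) (f0 fstar : Y -> R)
  (F0_density : F0 `<=` is_density mu)
  (f0_density : is_density mu f0)
  (fstar_min : KL_unique_minimizer mu f0 fstar F0)
  (F0_integrable : forall f, F0 f -> expect0 mu f0 (ratio f fstar) < +oo)
  (f0_integrable : \int[mu]_y ratio f0 fstar y < +oo)
  (A : set (Y -> R)) (A_hull : A `<=` mixture_hull mu F0) :
  [/\ hstar_uniformly_separated mu f0 fstar A ->
        hstar_inf_separated mu f0 fstar A,
      hstar_inf_separated mu f0 fstar A -> KL_separated mu f0 fstar A
    & mixture_convex mu A ->
        (hstar_inf_separated mu f0 fstar A <->
           hstar_uniformly_separated mu f0 fstar A) /\
        ((forall f, A f -> expect0 mu f0 (ratio f fstar) < +oo) ->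
           (KL_separated mu f0 fstar A <->
              hstar_inf_separated mu f0 fstar A))].
Proof.
have [fstar_F0 KLfin _ _] := fstar_min.
have fsd := F0_density _ fstar_F0.
have Ad f : A f -> is_density mu f.
  by move=> /A_hull /(mixture_hull_density F0_density).
have unif_inf : hstar_uniformly_separated mu f0 fstar A ->
    hstar_inf_separated mu f0 fstar A.
  move=> [a [eta [/andP[a0 a1] eta0 Aa]]]; exists eta => //.
  apply: le_lt_trans Aa; apply: ge_ereal_sup => _ [f Af <-].
  apply: (@le_trans _ _ (hstar mu f0 fstar a f)).
    by apply: ereal_inf_lbound; exists a => //=; rewrite !ltW.
  by apply: ereal_sup_ubound; exists f.
have inf_KL : hstar_inf_separated mu f0 fstar A -> KL_separated mu f0 fstar A.
  (* The argument bounds the infimum below by delta; halving makes the inequality strict. *)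
  move=> [delta delta0 Adelta]; exists (delta / 2)%R; first by rewrite divr_gt0.
  apply: (@lt_le_trans _ _ delta%:E); first by rewrite lte_fin; lra.
  apply: le_ereal_inf_tmp => _ [f Af <-]; rewrite leNgt; apply/negP => Kdelta.
  move: Adelta; apply/negP; rewrite -leNgt.
  apply: le_trans (ereal_sup_ubound (imageP _ Af)).
  apply: le_ereal_inf_tmp => _ [a /= a01 <-].
  exact: (hstar_ge f0_density fsd KLfin f0_integrable (Ad _ Af) a01 (ltW delta0)
    (ltW Kdelta)).
have KL_unif := hstar_uniformly_separated_of_KL (f0d := f0_density)
  fsd KLfin f0_integrable.
split => // Acvx; split; [split => // Ainf|move=> Aint; split => // AKL].
- apply: (KL_unif A Acvx (inf_KL Ainf)) => f Af.
  have [delta delta0 Adelta] := Ainf.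
  (* Some exponent has its moment below expR (- delta) < 1; it is not 0, where [hstar] equals 1. *)
  have /ereal_inf_lt[_ [a /= /andP[a0 a1] <-] ha] :
      ereal_inf [set hstar mu f0 fstar a f | a in [set a : R | (0 <= a <= 1)%R]]
        < (expR (- delta))%:E.
    exact: le_lt_trans (ereal_sup_ubound (imageP _ Af)) Adelta.
  have an0 : a != 0%R.
    apply/eqP => a_eq0; move: ha; rewrite /hstar a_eq0 eqxx lte_fin.
    by rewrite -[ltLHS]expR0 ltr_expR oppr_gt0 ltNge ltW.
  exists a; first by rewrite lt_neqAle eq_sym an0.
  rewrite -(hstarE f0_density fsd f0_integrable (Ad _ Af) an0).
  exact: lt_trans ha (ltry _).
- apply: unif_inf; apply: (KL_unif A Acvx AKL) => f Af.
  exists 1%R => //.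
  by rewrite -(expect0_ratioE f0_density fsd f0_integrable (Ad _ Af)) Aint.
Qed.
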